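(* Let $\kappa, m \ge 1$ be integers. Greedy routing in the directed graph $\mathcal{B}_{clockwise}(\kappa,m)$ with distance function $\delta_{clockwise}$ takes $3m-2$ hops in the worst-case. The average is less than $2m-1$ hops.
   Context: The $n$ nodes lie on a ring and are labeled $0,1,\dots,n-1$ according to their order on the ring; $x \bmod n$ always denotes an element of $[0,n-1]$, even when $x$ is negative or greater than $n-1$. Clockwise distance: $\delta_{clockwise}(u,v)=v-u$ if $v\ge u$, and $n+v-u$ otherwise. Graph $\mathcal{B}_{clockwise}(\kappa,m)$ (defined for integers $\kappa,m\ge 1$): it has $n=\kappa^m m$ nodes. For a node $u$ let $\ell(u)=(m-1)-(u \bmod m)$. Each node has $\kappa$ links; for node $u$ these directed links are to the nodes $(u+x)\bmod n$, where $x\in\{1+i m\kappa^{\ell(u)} : i\in[0,\kappa-1]\}$ ($i$ an integer). Greedy routing with a distance function $\delta$: given a target node $t$, a node $u$ with (out-)neighbors $N(u)$ forwards the message to its neighbor $v\in N(u)$ such that $\delta(v,t)=\min_{x\in N(u)}\delta(x,t)$. A hop is one forwarding step along an out-going link; the route is followed from the source until the target is reached.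
   Formalization: The exact worst case 3m-2 is claimed only for κ ≥ 2; for κ = 1 the graph is a directed m-cycle with worst case m-1, so only the upper bound 3m-2 is stated there. The average is over all ordered pairs of nodes, including source = target. *)

(* Defs.v *)
From mathcomp Require Import all_boot all_order all_algebra.

Set Implicit Arguments.
Unset Strict Implicit.
Unset Printing Implicit Defensive.

Section GreedyRouting.

Variables (V : finType) (N : V -> {set V}) (delta : V -> V -> nat).

(* [next t u] is the neighbour to which [u] forwards a message for [t]; any
   choice among several closest neighbours is allowed. *)
Definition greedy (next : V -> V -> V) : Prop :=
  forall t u : V,
    next t u \in N u /\
    forall x : V, x \in N u -> delta (next t u) t <= delta x t.

Lemma greedy_exists :
  (forall u, N u != set0) -> exists next, greedy next.
Proof.
move=> N0; have hN u : exists x, x \in N u by exact/set0Pn.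
exists (fun t u => [arg min_(v < xchoose (hN u) in N u) delta v t]) => t u.
by case: arg_minnP => [|v Nv min_v]; [exact: xchooseP | split].
Qed.

End GreedyRouting.

(* The route towards [t] stops the first time it meets [t]; in particular a
   message from a node to itself takes 0 hops. *)
Definition takes_hops (V : finType) (next : V -> V -> V) (s t : V) (h : nat) :
    Prop :=
  iter h (next t) s = t /\ forall j : nat, j < h -> iter j (next t) s <> t.

Definition worst_case (V : finType) (hops : V -> V -> nat) : nat :=
  \max_(s : V) \max_(t : V) hops s t.

(* The mean is over all ordered pairs (source, target), including s = t. *)
Definition average (V : finType) (hops : V -> V -> nat) : rat :=
  ((\sum_(s : V) \sum_(t : V) hops s t)%N%:R / (#|V| * #|V|)%N%:R)%R.

Definition delta_clockwise (n : nat) (u v : 'I_n) : nat :=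
  if u <= v then v - u else n + v - u.

Definition Bcw_size (kappa m : nat) : nat := kappa ^ m * m.

Definition level (m u : nat) : nat := (m - 1) - u %% m.

Definition Bcw_links (kappa m : nat) (u : 'I_(Bcw_size kappa m)) :
    {set 'I_(Bcw_size kappa m)} :=
  [set v : 'I_(Bcw_size kappa m) |
    [exists i : 'I_kappa,
      val v == (u + (1 + i * m * kappa ^ level m u)) %% Bcw_size kappa m]].

Lemma Bcw_links_neq0 (kappa m : nat) (u : 'I_(Bcw_size kappa m)) :
  0 < kappa -> Bcw_links u != set0.
Proof.
move=> k0; have n0 : 0 < Bcw_size kappa m by exact: leq_ltn_trans (ltn_ord u).
apply/set0Pn; exists (Ordinal (ltn_pmod (u + 1) n0)).
by rewrite inE; apply/existsP; exists (Ordinal k0); rewrite /= mul0n.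
Qed.

(* Main.v *)
(** A hop from a node of level [l] advances by [1] modulo [m], so the levels
    go down cyclically, and greedy routing subtracts from the remaining
    distance [d] the largest available link length [1 + i m kappa^l <= d].
    Once a node divisible by [m] is met, the next [m] hops reduce [d] below
    [m kappa^(m-1)], ..., [m kappa^0], and lead to the block of [m] consecutive
    nodes that contains the target [t]; the remaining distance is then
    [t %% m].  Hence the route from [s] to [t] takes at most
    [(- s mod m) + m + (t mod m)] hops; the two outer terms are at most [m - 1]
    and have mean [(m - 1) / 2], and the bound is not attained for [s = t].
    The worst case is attained from the source
    [1] at distance [m kappa^(m-1) + 2 m - 2]: the first [m - 1] hops use the
    longest link and leave the distance [2 m - 1], which takes as many hops. *)

Require Import Defs.
From mathcomp Require Import all_boot all_order all_algebra.
From mathcomp Require Import zify.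

Set Implicit Arguments.
Unset Strict Implicit.
Unset Printing Implicit Defensive.

Import GRing.Theory Num.Theory.

(** * Upper and lower bounds for first hitting times *)

Section FirstPassage.

Variables (T : Type) (f : T -> T) (t : T).

Definition hits_within (u : T) (h : nat) : Prop :=
  exists2 j, j <= h & iter j f u = t.

Definition avoids_before (u : T) (h : nat) : Prop :=
  forall j, j < h -> iter j f u <> t.

Lemma hits_withinS (u : T) (h : nat) :
  hits_within (f u) h -> hits_within u h.+1.
Proof. by case=> j lejh jt; exists j.+1; rewrite ?iterSr. Qed.

Lemma avoids_beforeS (u : T) (h : nat) :
  u <> t -> avoids_before (f u) h -> avoids_before u h.+1.
Proof. by move=> ut avoid [|j] // ltjh; rewrite iterSr; exact: avoid. Qed.

End FirstPassage.

(** * Arithmetic of the clockwise distance *)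

Section ClockwiseDistance.

Variable n : nat.
Implicit Types u v t : 'I_n.

Lemma delta_clockwise_ltn u t : delta_clockwise u t < n.
Proof.
by rewrite /delta_clockwise; have := ltn_ord u; have := ltn_ord t; case: ifP; lia.
Qed.

Lemma delta_clockwise_eq0 u t : (delta_clockwise u t == 0) = (u == t).
Proof.
rewrite -val_eqE /= /delta_clockwise.
by have := ltn_ord u; have := ltn_ord t; case: ifP; lia.
Qed.

(** Passing the target costs a full turn, hence the extra [n] in the second case. *)
Lemma delta_clockwise_shift u v t x :
    x <= n -> v = (u + x) %% n :> nat ->
  delta_clockwise v t = if x <= delta_clockwise u t then delta_clockwise u t - x
                        else n + delta_clockwise u t - x.
Proof.
move=> lexn; have := ltn_ord u; have := ltn_ord t.
rewrite /delta_clockwise => lttn ltun.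
have [ltuxn|lenux] := ltnP (u + x) n.
  by rewrite modn_small // => ->; do 3!case: ifP; lia.
rewrite -{1}(subnK lenux) modnDr modn_small; last lia.
by move=> ->; do 3!case: ifP; lia.
Qed.

Lemma delta_clockwise_addn u v x :
  x < n -> v = (u + x) %% n :> nat -> delta_clockwise u v = x.
Proof.
move=> ltxn; have := ltn_ord u; rewrite /delta_clockwise => ltun.
have [ltuxn|lenux] := ltnP (u + x) n.
  by rewrite modn_small // => ->; case: ifP; lia.
by rewrite -{1}(subnK lenux) modnDr modn_small; [move=> -> | ]; try case: ifP; lia.
Qed.

Lemma delta_clockwise_modn m u t :
  m %| n -> u + delta_clockwise u t = t %[mod m].
Proof.
have := ltn_ord u; rewrite /delta_clockwise => ltun /eqP mn.
case: ifP => [/subnKC -> //|_]; have -> : u + (n + t - u) = n + t by lia.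
by rewrite -modnDml mn.
Qed.

End ClockwiseDistance.

(** * Greedy routes: one hop, then upper and lower bounds *)

Section GreedyHop.

Variables (kappa m : nat).
Hypotheses (kappa_gt0 : 0 < kappa) (m_gt0 : 0 < m).

Local Notation n := (Bcw_size kappa m).

Variables (next : 'I_n -> 'I_n -> 'I_n) (t : 'I_n).
Hypothesis next_greedy : greedy (@Bcw_links kappa m) (@delta_clockwise n) next.

Local Notation d u := (delta_clockwise u t).
Local Notation hits u h := (hits_within (next t) t u h).
Local Notation avoids u h := (avoids_before (next t) t u h).

Lemma dvdn_Bcw_size : m %| n. Proof. exact: dvdn_mull. Qed.

(** Lets divisibility stand in for the level: a hop turns [m %| u + l.+1] into [m %| v + l], with no
    truncated subtraction. *)
Lemma level_eq (u l : nat) : l < m -> m %| u + l.+1 -> level m u = l.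
Proof.
move=> ltlm; rewrite /dvdn -modnDml /level.
have := ltn_pmod u m_gt0; move: (u %% m) => r ltrm.
have [lt|le] := ltnP (r + l.+1) m; first by rewrite modn_small //; lia.
by rewrite -{1}(subnK le) modnDr modn_small; lia.
Qed.

Lemma exists_level (u : nat) : exists2 l, l < m & m %| u + l.+1.
Proof.
exists (m - 1 - u %% m); first lia.
rewrite /dvdn -modnDml; have := ltn_pmod u m_gt0; move: (u %% m) => r ltrm.
by have -> : r + (m - 1 - r).+1 = m by [lia]; rewrite modnn.
Qed.

Lemma link_length_leq l i : l < m -> i < kappa -> 1 + i * (m * kappa ^ l) <= n.
Proof.
move=> ltlm ltik.
have le1 : kappa ^ l.+1 <= kappa ^ m by rewrite leq_pexp2l.
have : kappa ^ l.+1 * m <= n by rewrite leq_mul2r le1 orbT.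
have : i.+1 * (m * kappa ^ l) <= kappa * (m * kappa ^ l).
  by rewrite leq_mul2r ltik orbT.
have : 0 < m * kappa ^ l by rewrite muln_gt0 m_gt0 expn_gt0 kappa_gt0.
by rewrite expnS mulSn; lia.
Qed.

(** Among links that do not pass the target, the closest endpoint is that of the longest link; every
    link length is 1 modulo [m], which gives the last claim. *)
Lemma greedy_hop (u : 'I_n) (l : nat) :
    l < m -> m %| u + l.+1 -> u <> t ->
  exists i, [/\ i < kappa, 1 + i * (m * kappa ^ l) <= d u,
    forall j, j < kappa -> 1 + j * (m * kappa ^ l) <= d u -> j <= i,
    d (next t u) = d u - (1 + i * (m * kappa ^ l))
    & m %| next t u + l].
Proof.
move=> ltlm mul /eqP neq_ut.
have d_gt0 : 0 < d u by rewrite lt0n delta_clockwise_eq0.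
have P_gt0 : 0 < m * kappa ^ l by rewrite muln_gt0 m_gt0 expn_gt0 kappa_gt0.
have n_gt0 : 0 < n by exact: leq_ltn_trans (ltn_ord u).
have [] := next_greedy t u; rewrite inE => /existsP[[i ltik] /= /eqP vE] minv.
rewrite (level_eq ltlm mul) -mulnA in vE.
have dE := delta_clockwise_shift t (link_length_leq ltlm ltik) vE.
have le_d j : j < kappa -> 1 + j * (m * kappa ^ l) <= d u ->
    d (next t u) <= d u - (1 + j * (m * kappa ^ l)).
  move=> ltjk lejd; pose x := 1 + j * (m * kappa ^ l).
  have link : Ordinal (ltn_pmod (u + x) n_gt0) \in Bcw_links u.
    rewrite inE; apply/existsP; exists (Ordinal ltjk).
    by rewrite /= (level_eq ltlm mul) -mulnA.
  have lexn : x <= n by exact: link_length_leq.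
  have := minv _ link.
  by rewrite (delta_clockwise_shift t lexn (erefl _ : val (Ordinal _) = _)) lejd.
have leid : 1 + i * (m * kappa ^ l) <= d u.
  (* A link passing the target would leave at least [d u], as its length is at most [n]; the link of
     length 1 leaves less. *)
  rewrite leqNgt; apply/negP => ltdi.
  have := le_d 0 kappa_gt0; rewrite mul0n addn0 dE ifN -?ltnNge //.
  by have := link_length_leq ltlm ltik; lia.
rewrite leid in dE; exists i; split=> // [j ltjk lejd|].
  by rewrite -(leq_pmul2r P_gt0); have := le_d j ltjk lejd; rewrite dE; lia.
rewrite vE /dvdn -modnDml (modn_dvdm _ dvdn_Bcw_size) modnDml.
have -> : u + (1 + i * (m * kappa ^ l)) + l = (i * kappa ^ l) * m + (u + l.+1) by lia.
by rewrite modnMDl.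
Qed.

Lemma hits_within_delta (u : 'I_n) (h : nat) : d u <= h -> hits u h.
Proof.
elim: h u => [|h IHh] u.
  by rewrite leqn0 delta_clockwise_eq0 => /eqP ->; exists 0.
case: (eqVneq u t) => [-> _|/eqP neq_ut led]; first by exists 0.
have [l ltlm mul] := exists_level u.
have [i [_ _ _ dE _]] := greedy_hop ltlm mul neq_ut.
by apply/hits_withinS/IHh; rewrite dE; lia.
Qed.

Lemma hits_within_descent (u : 'I_n) (l : nat) :
    l <= m -> m %| u + l -> d u <= m * kappa ^ l ->
  (l = 0 -> d u < m) ->
  hits u (l + t %% m).
Proof.
elim: l u => [|l IHl] u lelm mul led d_lt.
  apply: hits_within_delta; rewrite addn0 in mul.
  (* Here [m] divides [u] and [d u < m], so [d u] is exactly [t %% m]. *)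
  rewrite -(delta_clockwise_modn u t dvdn_Bcw_size) -modnDml (eqP mul) add0n.
  by rewrite modn_small ?d_lt.
case: (eqVneq u t) => [->|/eqP neq_ut]; first by exists 0.
have [i [ltik leid maxi dE mvl]] := greedy_hop lelm mul neq_ut.
have d_lt' : d (next t u) < m * kappa ^ l.
  (* Either the next longer link exists and does not fit, or the longest one was used and the bound
     on [d u] gives the claim. *)
  rewrite dE; have [lt|le] := ltnP i.+1 kappa.
    by have := maxi _ lt; have := leqnn i; lia.
  have kE : kappa = i.+1 by lia.
  have PE : m * kappa ^ l.+1 = i * (m * kappa ^ l) + m * kappa ^ l.
    by rewrite -mulSnr -kE expnS mulnCA.
  by rewrite PE in led; lia.
apply/hits_withinS/IHl => //; first exact: ltnW.
  exact: ltnW.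
by move=> l0; rewrite l0 expn0 muln1 in d_lt'.
Qed.

(** The first [a] hops only serve to reach a multiple of [m]; the descent then starts with [l = m],
    where its distance bound is [n]. *)
Lemma hits_within_route (u : 'I_n) (a : nat) :
  m %| u + a -> hits u (a + (m + t %% m)).
Proof.
elim: a u => [|a IHa] u mua.
  apply: hits_within_descent => //; first by rewrite dvdn_addl // -(addn0 u).
    by rewrite mulnC; apply/ltnW/delta_clockwise_ltn.
  by lia.
case: (eqVneq u t) => [->|/eqP neq_ut]; first by exists 0.
(* Since [a] may exceed [m], the level of [u] is only [a %% m]. *)
have mua' : m %| u + (a %% m).+1.
  by move: mua; rewrite /dvdn -!addSnnS modnDmr.
have [i [_ _ _ _ mva]] := greedy_hop (ltn_pmod a m_gt0) mua' neq_ut.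
by apply/hits_withinS/IHa; move: mva; rewrite /dvdn modnDmr.
Qed.

(** Every link other than the shortest has length above [m], so each hop advances by 1. *)
Lemma avoids_before_delta (u : 'I_n) : d u <= m -> avoids u (d u).
Proof.
have [h dE] := ubnP (d u); elim: h u dE => // h IHh u ltdh ledm.
case: (posnP (d u)) => [->|d_gt0] //.
have neq_ut : u <> t by apply/eqP; rewrite -delta_clockwise_eq0 -lt0n.
have [l ltlm mul] := exists_level u.
have [i [_ leid _ dE _]] := greedy_hop ltlm mul neq_ut.
have lemP : m <= m * kappa ^ l by rewrite leq_pmulr // expn_gt0 kappa_gt0.
have i0 : i = 0 by case: i leid {dE} => // i; rewrite mulSn; lia.
rewrite i0 mul0n addn0 in dE.
have -> : d u = (d (next t u)).+1 by lia.
by apply: avoids_beforeS => //; apply: IHh; lia.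
Qed.

(** While the level is positive the longer links exceed [2 * m], which is more than the distance, so
    hops advance by 1 until distance [m] is left at level 0. *)
Lemma avoids_before_descent (u : 'I_n) (l : nat) :
    1 < kappa -> l < m -> m %| u + l.+1 -> d u = m + l ->
  avoids u (m + l).
Proof.
move=> kappa_gt1; elim: l u => [|l IHl] u ltlm mul dE.
  by rewrite -dE; apply: avoids_before_delta; lia.
have neq_ut : u <> t by apply/eqP; rewrite -delta_clockwise_eq0; lia.
have [i [_ leid _ dE' mvl]] := greedy_hop ltlm mul neq_ut.
have lemP : m * 2 <= m * kappa ^ l.+1.
  by rewrite leq_mul2l (leq_trans kappa_gt1) ?orbT // -{1}(expn1 kappa) leq_pexp2l.
have i0 : i = 0 by case: i leid {dE'} => // i; rewrite mulSn; lia.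
rewrite addnS; apply: avoids_beforeS => //; apply: IHl => //; first exact: ltnW.
by rewrite dE' i0; lia.
Qed.

(** The form of the distance is invariant: the longest link fits and its removal replaces [a] by
    [a - 1]. At [a = 0] the distance is [2 * m - 1] and the level [m - 1]. *)
Lemma avoids_before_route (u : 'I_n) (a : nat) :
    1 < kappa -> a < m -> m %| u + a -> d u = m * kappa ^ a + m.-1 + a ->
  avoids u (a + (m + m.-1)).
Proof.
move=> kappa_gt1; elim: a u => [|a IHa] u ltam mua dE.
  apply: avoids_before_descent; rewrite ?prednK //; last by rewrite dE; lia.
  by rewrite dvdn_addl // -(addn0 u).
have neq_ut : u <> t by apply/eqP; rewrite -delta_clockwise_eq0; lia.
have [i [ltik _ maxi dE' mva]] := greedy_hop (ltnW ltam) mua neq_ut.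
have PE : m * kappa ^ a.+1 = kappa.-1 * (m * kappa ^ a) + m * kappa ^ a.
  by rewrite -mulSnr prednK // expnS mulnCA.
have iE : i = kappa.-1.
  have : kappa.-1 <= i by apply: maxi; lia.
  by lia.
apply: avoids_beforeS => //; apply: IHa => //; first exact: ltnW.
by rewrite dE' dE iE PE; lia.
Qed.

End GreedyHop.

(** * Sums of residues modulo [m] *)

Lemma sum_modnS (m q : nat) :
  \sum_(i < q * m) (i.+1 %% m) = \sum_(i < q * m) (i %% m).
Proof.
apply: (@addnI (0 %% m)).
rewrite -(big_ord_recl _ (fun i : 'I__ => i %% m)).
by rewrite big_ord_recr /= modnMl mod0n addn0.
Qed.

(** Both sums agree by reversal and a shift; then [i] and [q * m - 1 - i] have residues adding up to
    [m - 1]. *)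
Lemma sum_modn_rev (m q : nat) : 0 < m ->
  \sum_(i < q * m) ((q * m - i) %% m) + \sum_(i < q * m) (i %% m) = q * m * m.-1.
Proof.
move=> m_gt0.
have -> : \sum_(i < q * m) ((q * m - i) %% m) = \sum_(i < q * m) (i %% m).
  rewrite -sum_modnS (reindex_inj rev_ord_inj) /=.
  by apply: eq_bigr => i _; rewrite subKn.
rewrite {1}(reindex_inj rev_ord_inj) -big_split /=.
rewrite -[q * m in RHS]card_ord -sum_nat_const; apply: eq_bigr => i _.
have := ltn_ord i; rewrite -ltn_divLR // => ltiq.
have := divn_eq i m; have := ltn_pmod i m_gt0.
move: (nat_of_ord i) (i %/ m) (i %% m) ltiq => j p r ltpq ltrm jE.
have -> : q * m - j.+1 = (q - p.+1) * m + (m.-1 - r) by nia.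
by rewrite modnMDl modn_small; lia.
Qed.

Theorem theorem1 (kappa m : nat) (hkappa : 1 <= kappa) (hm : 1 <= m)
    (next : 'I_(Bcw_size kappa m) -> 'I_(Bcw_size kappa m) ->
            'I_(Bcw_size kappa m))
    (hnext : greedy (@Bcw_links kappa m)
                    (@delta_clockwise (Bcw_size kappa m)) next) :
  exists hops : 'I_(Bcw_size kappa m) -> 'I_(Bcw_size kappa m) -> nat,
    [/\ forall s t, takes_hops next s t (hops s t),
        worst_case hops <= 3 * m - 2,
        2 <= kappa -> worst_case hops = 3 * m - 2
      & (average hops < (2 * m - 1)%N%:R :> rat)%R].
Proof.
have route (s : 'I_(Bcw_size kappa m)) : m %| s + (Bcw_size kappa m - s) %% m.
  rewrite /dvdn modnDmr subnKC; first exact: dvdn_Bcw_size.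
  exact: ltnW.
have reach s t : exists h, iter h (next t) s == t.
  have [h _ /eqP ht] := hits_within_route hkappa hm t hnext (route s).
  by exists h.
pose hops s t := ex_minn (reach s t).
have hopsP s t : takes_hops next s t (hops s t).
  rewrite /hops; case: ex_minnP => h /eqP ht minh; split=> // j ltjh /eqP/minh.
  by rewrite leqNgt ltjh.
have hops_le s t : hops s t <= (Bcw_size kappa m - s) %% m + (m + t %% m).
  have [j lej jt] := hits_within_route hkappa hm t hnext (route s).
  apply: leq_trans lej; rewrite leqNgt; apply/negP => ltj.
  by have [_ /(_ _ ltj)] := hopsP s t.
have worst_le : worst_case hops <= 3 * m - 2.
  apply/bigmax_leqP => s _; apply/bigmax_leqP => t _.
  apply: leq_trans (hops_le s t) _.
  by have := ltn_pmod t hm; have := ltn_pmod (Bcw_size kappa m - s) hm; lia.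
exists hops; split=> // [kappa_gt1|].
  apply/eqP; rewrite eqn_leq worst_le /=.
  (* The distance of [avoids_before_route] at [a = m - 1], which fits source 1; [D < n] follows from
     [m - 1 < kappa ^ (m - 1)]. *)
  pose D := m * kappa ^ m.-1 + m.-1 + m.-1.
  have nE : Bcw_size kappa m = kappa * kappa ^ m.-1 * m.
    by rewrite -expnS prednK.
  have [n_gt1 D_lt] : 1 < Bcw_size kappa m /\ D < Bcw_size kappa m.
    have := ltn_expl m.-1 kappa_gt1.
    by rewrite /D nE; move: (kappa ^ _) => p ltp; split; nia.
  pose s := Ordinal n_gt1; pose t := Ordinal (ltn_pmod (1 + D) (ltnW n_gt1)).
  have dE : delta_clockwise s t = D by apply: delta_clockwise_addn.
  have far : avoids_before (next t) t s (m.-1 + (m + m.-1)).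
    apply: avoids_before_route => //; first by rewrite prednK.
    by rewrite /= add1n prednK.
  apply: leq_trans (leq_trans (leq_bigmax (F := hops s) t) _); last first.
    exact: (leq_bigmax (F := fun s => \max_t hops s t)).
  rewrite leqNgt; apply/negP => lth; case: (hopsP s t) => ht _.
  by apply: (far _ _ ht); lia.
have n_gt0 : 0 < Bcw_size kappa m by rewrite muln_gt0 expn_gt0 hkappa.
rewrite /average card_ord ltr_pdivrMr; last first.
  by rewrite ltr0n (muln_gt0 (Bcw_size _ _)) n_gt0.
rewrite -natrM ltr_nat.
(* The indicator fits under the bound because [hops s s = 0] while the bound is at least [m]; it
   adds [n] to the total, which makes the final inequality strict. *)
have: \sum_s \sum_t (hops s t + (s == t)) <=
      \sum_(s < Bcw_size kappa m) \sum_(t < Bcw_size kappa m)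
         ((Bcw_size kappa m - s) %% m + (m + t %% m)).
  apply: leq_sum => s _; apply: leq_sum => t _.
  case: eqP => [<-|_]; last by rewrite addn0.
  have [_ hops0] := hopsP s s; have -> : hops s s = 0.
    by case: (posnP (hops s s)) => // /hops0.
  by lia.
under eq_bigr do rewrite big_split /=.
rewrite big_split /=.
have -> : \sum_s \sum_(t < Bcw_size kappa m) (s == t) = Bcw_size kappa m.
  rewrite -[RHS]card_ord -sum1_card; apply: eq_bigr => s _.
  by rewrite (bigD1 s) //= eqxx big1 // => t; rewrite eq_sym => /negPf ->.
under [X in _ <= X]eq_bigr
  do rewrite big_split sum_nat_const card_ord big_split /= sum_nat_const card_ord.
rewrite big_split /= -big_distrr /= sum_nat_const card_ord.
have := sum_modn_rev (kappa ^ m) hm; rewrite -/(Bcw_size kappa m).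
move: (\sum_(s < _) \sum_(t < _) _)%N (\sum_(i < _) ((_ - i) %% m))%N
  (\sum_(i < _) (i %% m))%N => S A T.
move: (Bcw_size kappa m) n_gt0 => n n_gt0 AT.
(* The right-hand side is [n * (n * (m - 1)) + n * (n * m)], that is [n * n * (2 * m - 1)]. *)
by rewrite mulnDr addnCA -mulnDr AT; case: (m) hm => // p _; nia.
Qed.
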